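(* Fix an integer $k$. Any $\alpha$-approximation of the metric of $GRID_n$ by a distribution over dominating metrics of graphs of treewidth $k$ has $\alpha=\Omega(\log n)$ (the implicit constant depending on $k$).
   Context: $GRID_n$ denotes the planar $n\times n$ grid graph with its shortest-path metric $d$. An $\alpha$-approximation of $d$ by a distribution over dominating metrics of graphs of treewidth $k$ is a probability distribution over pairs $(H,\Phi_H)$, where $H$ is a graph of treewidth $k$ and $\Phi_H$ maps vertices of $GRID_n$ to vertices of $H$, such that $d_H(\Phi_H(x),\Phi_H(y))\ge d(x,y)$ always and $\mathbb{E}[d_H(\Phi_H(x),\Phi_H(y))]\le \alpha\, d(x,y)$ for all vertices $x,y$. *)

(* Defs.v *)
From HB Require Import structures.
From mathcomp Require Import all_boot all_order all_algebra.
From mathcomp Require Import all_classical all_reals all_analysis.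
From mathcomp Require Import measurable_realfun.
Set Implicit Arguments. Unset Strict Implicit. Unset Printing Implicit Defensive.
Import Order.TTheory GRing.Theory Num.Theory.
Local Open Scope classical_set_scope.
Local Open Scope ring_scope.

Section Defs.
Variable R : realType.

Fixpoint walk_cost {T : Type} (w : T -> T -> R) (x : T) (s : seq T) : R :=
  match s with
  | [::] => 0
  | y :: s' => w x y + walk_cost w y s'
  end.

(** Shortest-path distance in a (weighted) graph with adjacency [adj] and
    edge weights [w]: infimum of the weights of walks from x to y
    (+oo if there is no such walk). *)
Definition sp_dist {T : eqType} (adj : rel T) (w : T -> T -> R) (x y : T) : \bar R :=
  ereal_inf [set (walk_cost w x s)%:E | s in [set s : seq T | path adj x s /\ last x s = y]].

(** A finite undirected graph with positive edge lengths on vertex set 'I_size: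
    u,v adjacent iff u != v and w u v > 0; weights are symmetric. *)
Record wgraph := WGraph {
  wg_size : nat;
  wg_w : 'I_wg_size -> 'I_wg_size -> R;
  wg_sym : forall u v, wg_w u v = wg_w v u }.

Definition wg_adj (G : wgraph) : rel 'I_(wg_size G) :=
  fun u v => (u != v) && (0 < wg_w (w:=G) u v).

Definition wg_dist (G : wgraph) (u v : 'I_(wg_size G)) : \bar R :=
  sp_dist (wg_adj (G:=G)) (wg_w (w:=G)) u v.

End Defs.

Definition grid_adj (n : nat) : rel ('I_n * 'I_n) :=
  fun p q =>
    ((p.1 == q.1) && ((p.2.+1 == q.2 :> nat) || (q.2.+1 == p.2 :> nat))) ||
    ((p.2 == q.2) && ((p.1.+1 == q.1 :> nat) || (q.1.+1 == p.1 :> nat))).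

Definition grid_dist (R : realType) (n : nat) (x y : 'I_n * 'I_n) : \bar R :=
  sp_dist (grid_adj (n:=n)) (fun _ _ => (1 : R)) x y.

Definition is_tree (p : nat) (t : rel 'I_p) : Prop :=
  [/\ (0 < p)%N, symmetric t, irreflexive t,
      (forall a b, connect t a b) &
      (forall c : seq 'I_p, (2 < size c)%N -> ~~ ucycleb t c)].

Definition treewidth_le (V : finType) (e : rel V) (k : nat) : Prop :=
  exists (p : nat) (t : rel 'I_p) (B : 'I_p -> {set V}),
    [/\ is_tree t,
        (forall v, exists i, v \in B i),
        (forall u v, e u v -> exists i, (u \in B i) && (v \in B i)),
        (forall v i j, v \in B i -> v \in B j ->
            connect [rel a b | [&& t a b, v \in B a & v \in B b]] i j) &
        (forall i, (#|B i| <= k.+1)%N)].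

Definition tw_approx (R : realType) (k n : nat)
    (d : measure_display) (Omega : measurableType d) (P : probability Omega R)
    (H : Omega -> wgraph R) (Phi : forall w, 'I_n * 'I_n -> 'I_(wg_size (H w)))
    (alpha : R) : Prop :=
  [/\ (forall w, treewidth_le (@wg_adj R (H w)) k),
      (forall x y, measurable_fun (setT : set Omega)
                     (fun w => wg_dist (Phi w x) (Phi w y) : \bar R)),
      (forall w x y, (grid_dist R x y <= wg_dist (Phi w x) (Phi w y))%E) &
      (forall x y, (\int[P]_w wg_dist (Phi w x) (Phi w y)
                      <= alpha%:E * grid_dist R x y)%E)].

(* Main.v *)
(* Fix a scale r and a box of the grid with side s = 4(k+1)r. Suppose fewer than
   2(k+1)r of its edges have length at least r in H; then more than half of the
   rows and of the columns contain no such edge. The union of the open r-balls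
   of H centred at the images of such a row and such a column is connected, and
   any two of these crosses meet, so some bag of the tree decomposition hits all
   of them. But two grid points at distance < r from the same vertex of H are at
   grid distance < 2r, so the k+1 vertices of a bag touch at most 2(k+1)r rows
   and as many columns, a contradiction. Hence Omega(n^2/r) grid edges have
   length at least r; summing over dyadic r gives a total length
   Omega(n^2 log n), whereas its expectation is at most 2 alpha n^2. *)

Require Import Defs.
From HB Require Import structures.
From mathcomp Require Import all_boot all_order all_algebra.
From mathcomp Require Import all_classical all_reals all_analysis.
From mathcomp Require Import measurable_realfun zify lra.
Set Implicit Arguments. Unset Strict Implicit. Unset Printing Implicit Defensive.
Import Order.TTheory GRing.Theory Num.Theory.

(** * Trees, tree decompositions and brambles *)

Definition connected_in (V : finType) (e : rel V) (C : {set V}) : Prop :=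
  {in C &, forall u v, connect [rel a b | [&& e a b, a \in C & b \in C]] u v}.

Lemma connect_homo (T : finType) (e e' : rel T) x y :
  (forall a b, e a b -> e' a b) -> connect e x y -> connect e' x y.
Proof. by move=> ee'; apply: connect_sub => a b /ee'; apply: connect1. Qed.

(** A simple path from j to i avoiding the edge ij would close up with it into a cycle of length at
    least 3: a path of no edge would make ij a loop, and a path of one edge would be ij itself. *)
Lemma tree_bridge (p : nat) (t : rel 'I_p) (i j : 'I_p) : is_tree t -> t i j ->
  ~~ connect [rel a b | [&& t a b, (a, b) != (i, j) & (a, b) != (j, i)]] j i.
Proof.
case=> _ tsym tirr _ acyc tij; apply/negP => /connectP[q qp qi].
case/shortenP: qp qi => q' q'p q'u _ qi.
have := acyc (j :: q').
have tq : path t j q' by apply: sub_path q'p => a b /= /andP[].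
case: q' q'p q'u qi tq => [|x [|y q']] /= q'p q'u qi tq.
- by move: tij; rewrite qi tirr.
- by move: q'p; rewrite -qi eqxx !andbF.
- have cy : cycle t [:: j, x, y & q'].
    by rewrite (cycle_path j) /= -qi tij.
  by rewrite /ucycleb cy => /(_ isT) /negP.
Qed.

(* Iterating f reaches a cycle, which in a tree can only have length 2. *)
Lemma tree_two_cycle (p : nat) (t : rel 'I_p) (f : 'I_p -> 'I_p) :
  is_tree t -> (forall i, t i (f i)) -> exists i, f (f i) = i.
Proof.
case=> p0 _ tirr _ acyc tf; pose x := Ordinal p0.
have /trajectP[m ltm xm] := looping_order f x.
(* [y] is the point of the orbit where the iteration first returns, [l] the length of the cycle
   through it. *)
pose y := iter m f x; pose l := order f x - m.
have l0 : 0 < l by rewrite subn_gt0.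
have yl : iter l f y = y by rewrite -iterD subnK ?xm // ltnW.
have := orbit_uniq f x.
rewrite /orbit -(subnKC (ltnW ltm)) trajectD cat_uniq => /and3P[_ _ uy].
rewrite -/y -/l in uy.
have cy : cycle t (traject f y l).
  move: yl; rewrite -(prednK l0) iterSr trajectS /= => yl.
  rewrite -[X in rcons _ X]yl -trajectSr.
  by apply: sub_path (fpath_traject f y _) => a b /= /eqP <-.
case: (l) l0 yl uy cy => [|[|[|n]]] // _ yl uy cy.
- by move: (tf y); rewrite {1}[f y]yl tirr.
- by exists y.
- by have := acyc (traject f y n.+3); rewrite size_traject /ucycleb cy uy => /(_ isT).
Qed.

(** A walk inside C lifts to the tree: each of its edges lies in a common bag, and consecutive such
    bags share a vertex of C, whose bags are linked. *)
Lemma bags_connected (V : finType) (e : rel V) (p : nat) (t : rel 'I_p)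
    (B : 'I_p -> {set V}) (C : {set V}) :
  (forall u v, e u v -> exists i, (u \in B i) && (v \in B i)) ->
  (forall v i j, v \in B i -> v \in B j ->
     connect [rel a b | [&& t a b, v \in B a & v \in B b]] i j) ->
  connected_in e C -> connected_in t [set i | ~~ [disjoint B i & C]].
Proof.
move=> Be Bv Cc.
set S := [set i | _].
have inS v i : v \in B i -> v \in C -> i \in S.
  by move=> vB vC; rewrite inE; apply/pred0Pn; exists v; rewrite /= vB.
have onev v i j : v \in C -> v \in B i -> v \in B j ->
    connect [rel a b | [&& t a b, a \in S & b \in S]] i j.
  move=> vC vi vj; apply: connect_homo (Bv v i j vi vj) => a b /= /and3P[-> va vb].
  by rewrite (inS v a) // (inS v b).
move=> i j; rewrite !inE => /pred0Pn[u /= /andP[ui uC]] /pred0Pn[v /= /andP[vj vC]].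
have /connectP[q] := Cc u v uC vC.
elim: q u i ui uC => [|w q IH] u i ui uC /=.
  by move=> _ vu; apply: (onev u) => //; rewrite -vu.
case/andP=> /and3P[euw _ wC] qp vq.
have [l /andP[ul wl]] := Be _ _ euw.
exact: connect_trans (onev u _ _ uC ui ul) (IH w l wl wC qp vq).
Qed.

(* If no bag met all the [C x], each tree node i would miss some [C x], whose
   bags then all lie in the branch at i through a neighbour [f i]; an edge with
   [f (f i) = i] yields two disjoint families of bags. *)
Lemma treewidth_bramble (V : finType) (e : rel V) (k : nat) (I : Type)
    (C : I -> {set V}) :
  treewidth_le e k -> (forall x, connected_in e (C x)) ->
  (forall x y, ~~ [disjoint C x & C y]) ->
  exists2 B : {set V}, #|B| <= k.+1 & forall x, ~~ [disjoint B & C x].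
Proof.
case=> p [t [B [tT Bcov Be Bv Bk]]] Cc CI; apply: contrapT => nB.
pose S x := [set i | ~~ [disjoint B i & C x]].
have Sc x : connected_in t (S x) by apply: (bags_connected Be Bv).
have SI x y : exists i, (i \in S x) && (i \in S y).
  have /pred0Pn[v /= /andP[vx vy]] := CI x y.
  have [i vi] := Bcov v; exists i; rewrite !inE.
  by apply/andP; split; apply/pred0Pn; exists v; rewrite /= vi.
have step i : exists j, exists2 x, t i j &
    forall y, y \in S x -> connect [rel a b | [&& t a b, a != i & b != i]] j y.
  have [x iS] : exists x, i \notin S x.
    apply: contrapT => nx; apply: nB; exists (B i) => // x.
    by apply: contrapT => /negP nd; apply: nx; exists x; rewrite inE.
  have [y /andP[yS _]] := SI x x.
  have [_ _ _ tc _] := tT; have /connectP[q qp yq] := tc i y.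
  case/shortenP: qp yq => q' q'p q'u _ yq.
  case: q' q'p q'u yq => [|j s] /=; first by move=> _ _ yi; rewrite -yi yS in iS.
  case/andP=> tij js /andP[ijs _] ys; exists j, x => // z zS.
  (* The rest of the simple path leads from j to y without i; since [S x] is connected and misses i,
     all of it lies on that side. *)
  apply: (@connect_trans _ _ y).
    apply/connectP; exists s => //.
    elim: s j js ijs {tij ys} => //= a s IH j /andP[tja as_].
    rewrite !inE !negb_or => /and3P[ij ia is_].
    by rewrite tja eq_sym ij eq_sym ia IH // inE negb_or ia.
  apply: connect_homo (Sc x y z yS zS) => a b /= /and3P[-> aS bS].
  by rewrite (memPn iS) // (memPn iS).
have [f fP] := choice step.
have tf i : t i (f i) by have [] := fP i.
have [i ffi] := tree_two_cycle tT tf.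
have [x _ xP] := fP i; have [y _ yP] := fP (f i); rewrite ffi in yP.
have [z /andP[zx zy]] := SI x y.
have /negP[] := tree_bridge tT (tf i).
have tsym : symmetric t by case: tT.
(* The node z is reached from [f i] avoiding i, and from i avoiding [f i]; the two walks together
   bypass the edge. *)
apply: (@connect_trans _ _ z).
  apply: connect_homo (xP z zx) => a b /= /and3P[-> ai bi].
  by rewrite !xpair_eqE (negPf ai) (negPf bi) andbF.
rewrite (sym_connect_sym _); last first.
  move=> a b /=; rewrite tsym; congr (_ && _).
  by rewrite andbC !xpair_eqE ![_ && (a == _)]andbC.
apply: connect_homo (yP z zy) => a b /= /and3P[-> ai bi].
by rewrite !xpair_eqE (negPf ai) (negPf bi) !andbF.
Qed.

Lemma connected_in_star (V : finType) (e : rel V) (C : {set V}) (x : V) :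
  symmetric e ->
  {in C, forall v, connect [rel a b | [&& e a b, a \in C & b \in C]] x v} ->
  connected_in e C.
Proof.
move=> esym xC u v uC vC; apply: connect_trans (xC v vC).
rewrite (sym_connect_sym _) ?xC // => a b /=.
by rewrite esym; congr (_ && _); rewrite andbC.
Qed.

Local Open Scope ring_scope.

(** * Walks and open balls in a weighted graph *)

Section WeightedGraph.
Context {R : realType} (G : wgraph R).
Local Notation V := 'I_(wg_size G).
Local Notation adj := (@wg_adj R G).
Local Notation cost := (walk_cost (wg_w (w:=G))).
Implicit Types (u v x : V) (b c : R).

Lemma wg_adj_sym : symmetric adj.
Proof. by move=> u v; rewrite /wg_adj eq_sym wg_sym. Qed.

Lemma walk_cost_ge0 u s : path adj u s -> 0 <= cost u s.
Proof.
elim: s u => //= v s IH u /andP[/andP[_ /ltW w0] vs].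
by rewrite addr_ge0 ?IH.
Qed.

Lemma walk_cost_cat u s s' : cost u (s ++ s') = cost u s + cost (last u s) s'.
Proof. by elim: s u => [|v s IH] u /=; rewrite ?add0r // IH addrA. Qed.

Lemma walk_rev u s : path adj u s ->
  exists s', [/\ path adj (last u s) s', last (last u s) s' = u &
                 cost (last u s) s' = cost u s].
Proof.
elim: s u => [|v s IH] u /=; first by exists [::].
case/andP=> uv /IH[s' [ps ls cs]]; exists (rcons s' u).
rewrite rcons_path ps ls wg_adj_sym uv last_rcons; split=> //.
by rewrite -cats1 walk_cost_cat cs ls /= addr0 wg_sym addrC.
Qed.

Lemma wg_dist_le u s : path adj u s -> (wg_dist u (last u s) <= (cost u s)%:E)%E.
Proof. by move=> us; apply: ereal_inf_lbound; exists s. Qed.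

(** The distance is an infimum, possibly infinite; a strict bound always yields an actual walk,
    which is why the balls are taken open. *)
Lemma wg_dist_ltP u v c :
  (wg_dist u v < c%:E)%E <->
  exists s, [/\ path adj u s, last u s = v & cost u s < c].
Proof.
split=> [/ereal_inf_lt[_ [s [us uv] <-]] sc|[s [us <- sc]]]; first by exists s.
by apply: le_lt_trans (wg_dist_le us) _; rewrite lte_fin.
Qed.

Lemma wg_dist_ge0 u v : (0 <= wg_dist u v)%E.
Proof.
apply: le_ereal_inf_tmp => _ [s [us _] <-].
by rewrite lee_fin walk_cost_ge0.
Qed.

Lemma wg_dist_lt_sym u v c : (wg_dist u v < c%:E)%E -> (wg_dist v u < c%:E)%E.
Proof.
move=> /wg_dist_ltP[s [us <- sc]]; have [s' [ps ls cs]] := walk_rev us.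
by apply/wg_dist_ltP; exists s'; rewrite cs.
Qed.

Lemma wg_dist_lt_trans v u x b c :
  (wg_dist u v < b%:E)%E -> (wg_dist v x < c%:E)%E ->
  (wg_dist u x < (b + c)%:E)%E.
Proof.
move=> /wg_dist_ltP[s [us <- sb]] /wg_dist_ltP[s' [us' <- sc]].
apply/wg_dist_ltP; exists (s ++ s').
by rewrite cat_path us us' last_cat walk_cost_cat ltrD.
Qed.

Lemma wg_dist_lt_refl u c : 0 < c -> (wg_dist u u < c%:E)%E.
Proof. by move=> c0; apply/wg_dist_ltP; exists [::]. Qed.

(** Weights along a walk are positive, so every prefix of a walk of cost below c also costs less
    than c, and the walk never leaves the ball. *)
Lemma wg_ball_connect u v c (C : {set V}) :
  (forall x, (wg_dist u x < c%:E)%E -> x \in C) -> (wg_dist u v < c%:E)%E ->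
  connect [rel a b | [&& adj a b, a \in C & b \in C]] u v.
Proof.
move=> uC /wg_dist_ltP[s]; elim/last_ind: s v => [|s x IH] v.
  by case=> _ <- _; apply: connect0.
rewrite rcons_path last_rcons -cats1 walk_cost_cat /= addr0.
case=> /andP[us ex] <- sc.
have sc' : cost u s < c.
  apply: le_lt_trans sc; rewrite lerDl; apply: ltW.
  by case/andP: ex.
apply: connect_trans (IH (last u s) _) _; first by [].
apply: connect1; rewrite /= ex !uC //; apply/wg_dist_ltP.
  exists (rcons s x).
  by rewrite rcons_path us ex last_rcons -cats1 walk_cost_cat /= addr0.
by exists s.
Qed.

End WeightedGraph.

(** * Stretched edges in one box *)

(** All elements lie in the window of length m that starts at the least one. *)
Lemma card_close_le (s m : nat) (A : {set 'I_s}) :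
  {in A &, forall a b : 'I_s, (a < b + m)%N} -> (#|A| <= m)%N.
Proof.
move=> Am; have [->|/set0Pn[a0 a0A]] := eqVneq A finset.set0; first by rewrite cards0.
case: (arg_minnP (fun a : 'I_s => a : nat) a0A) => a aA amin.
have m0 : (0 < m)%N by have := Am _ _ aA aA; rewrite -[X in (X < _)%N]addn0 ltn_add2l.
case: m Am m0 => // m Am _.
pose f (b : 'I_s) : 'I_m.+1 := inord (b - a).
rewrite -[X in (_ <= X)%N]card_ord -(card_in_imset (f := f)).
  exact: max_card.
move=> b c bA cA /(congr1 val) /=; have lt_m x : x \in A -> (x - a < m.+1)%N.
  by move=> xA; rewrite ltn_subLR ?amin // Am.
rewrite !inordK ?lt_m // => /eqP; rewrite -(eqn_add2r a) !subnK ?amin // => /eqP.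
exact: val_inj.
Qed.

(* Domination of the grid metric is only used through coordinate differences. *)
Definition noncontracting (R : realType) (G : wgraph R) (N : nat)
    (phi : nat -> nat -> 'I_(wg_size G)) :=
  forall a b a' b' c, (a < N)%N -> (b < N)%N -> (a' < N)%N -> (b' < N)%N ->
     (wg_dist (phi a b) (phi a' b') < c%:E)%E ->
     a%:R < a'%:R + c /\ b%:R < b'%:R + c.

(* [C a b] is the union of the balls of radius r around the images of the row a
   and the column b; two such crosses always meet. *)
Lemma box_stretched_edges (R : realType) (k : nat) (G : wgraph R)
    (phi : nat -> nat -> 'I_(wg_size G)) (r s : nat) :
  treewidth_le (@wg_adj R G) k -> (0 < r)%N -> (4 * (k.+1 * r) <= s)%N ->
  noncontracting s phi ->
  (2 * (k.+1 * r) <= \sum_(a < s) \sum_(b < s)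
     ((r%:R%:E <= wg_dist (phi a b) (phi a b.+1))%E +
      (r%:R%:E <= wg_dist (phi a b) (phi a.+1 b))%E))%N.
Proof.
move=> tw r0 rs dom; rewrite leqNgt; apply/negP => few.
have r0' : 0 < r%:R :> R by rewrite ltr0n.
pose good (h : 'I_s -> 'I_s -> bool) := [set a | [forall b, ~~ h a b]].
(* Each bad row contains a marked edge, so fewer than 2(k+1)r of the at least 4(k+1)r rows are
   bad. *)
have goodP (h : 'I_s -> 'I_s -> bool) :
    (\sum_(a < s) \sum_(b < s) h a b < 2 * (k.+1 * r))%N ->
    (2 * (k.+1 * r) < #|good h|)%N.
  move=> hlt; rewrite -(ltn_add2l (2 * (k.+1 * r))) -mulnDl.
  apply: leq_ltn_trans rs _; rewrite -[X in (X < _)%N]card_ord -(cardsC (good h)) addnC.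
  rewrite ltn_add2r; apply: leq_ltn_trans hlt.
  rewrite -sum1_card big_mkcond; apply: leq_sum => a _.
  rewrite !inE negb_forall; case: existsP => //= -[b]; rewrite negbK => hb.
  by rewrite (bigD1 b) //= hb.
pose touch (psi : nat -> nat -> 'I_(wg_size G)) (v : 'I_(wg_size G)) :=
  [set a : 'I_s | [exists b : 'I_s, (wg_dist (psi a b) v < r%:R%:E)%E]].
(* Two rows touching the ball around v have images at distance below 2r, so their indices differ by
   less than 2r. *)
have touchP (psi : nat -> nat -> 'I_(wg_size G)) v : (forall a b a' b' : 'I_s, forall c,
    (wg_dist (psi a b) (psi a' b') < c%:E)%E -> a%:R < a'%:R + c) ->
    (#|touch psi v| <= 2 * r)%N.
  move=> dpsi; apply: card_close_le => a a'; rewrite !inE.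
  move=> /existsP[b vb] /existsP[b' /wg_dist_lt_sym vb'].
  have := dpsi _ _ _ _ _ (wg_dist_lt_trans vb vb').
  by rewrite mul2n -addnn -!natrD ltr_nat.
(* The vertices of B touch at most 2(k+1)r rows in all, fewer than there are good ones. Keeping
   [psi] and [h] general covers columns too, by transposition. *)
have freeP (psi : nat -> nat -> 'I_(wg_size G)) (h : 'I_s -> 'I_s -> bool)
      (B : {set 'I_(wg_size G)}) : (#|B| <= k.+1)%N ->
    (forall a b a' b' : 'I_s, forall c,
    (wg_dist (psi a b) (psi a' b') < c%:E)%E -> a%:R < a'%:R + c) ->
    (\sum_(a < s) \sum_(b < s) h a b < 2 * (k.+1 * r))%N ->
    exists2 a, a \in good h & forall v, v \in B -> a \notin touch psi v.
  move=> Bk dpsi /goodP hgood.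
  have /subsetPn[a ag an] : ~~ (good h \subset \bigcup_(v in B) touch psi v).
    apply/negP => /subset_leq_card; rewrite leqNgt => /negP; apply.
      apply: leq_ltn_trans hgood.
    apply: (@leq_trans (\sum_(v in B) #|touch psi v|)%N).
      have := unstable.card_big_setU (enum 'I_(wg_size G)) (mem B) (touch psi).
      by rewrite !big_enum_cond.
    apply: (@leq_trans (\sum_(v in B) 2 * r)%N).
      by apply: leq_sum => v _; apply: touchP.
    by rewrite sum_nat_const mulnCA leq_mul2l leq_mul2r Bk orbT.
  exists a => // v vB; apply: contra an => av.
  by apply/bigcupP; exists v.
pose hr (a b : 'I_s) := (r%:R%:E <= wg_dist (phi a b) (phi a b.+1))%E.
pose hc (b a : 'I_s) := (r%:R%:E <= wg_dist (phi a b) (phi a.+1 b))%E.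
pose phi' b a := phi a b.
pose C (ab : {a | a \in good hr} * {b | b \in good hc}) :=
  [set v | [exists x : 'I_s, (wg_dist (phi (val ab.1) x) v < r%:R%:E)%E
            || (wg_dist (phi x (val ab.2)) v < r%:R%:E)%E]].
have Cc ab : connected_in (@wg_adj R G) (C ab).
  case: ab => -[a ag] [b bg].
  have C1 (x : 'I_s) v : (wg_dist (phi a x) v < r%:R%:E)%E ->
      v \in C (exist _ a ag, exist _ b bg).
    by move=> ?; rewrite inE; apply/existsP; exists x; apply/orP; left.
  have C2 (x : 'I_s) v : (wg_dist (phi x b) v < r%:R%:E)%E ->
      v \in C (exist _ a ag, exist _ b bg).
    by move=> ?; rewrite inE; apply/existsP; exists x; apply/orP; right.
  set D := C _ in C1 C2 *.
  pose e := [rel u v | [&& @wg_adj R G u v, u \in D & v \in D]].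
  have esym : connect_sym e.
    apply: sym_connect_sym => u v /=.
    by rewrite wg_adj_sym; congr (_ && _); rewrite andbC.
  (* Consecutive images along a good row are at distance below r, so each lies in the ball around
     the previous one, which is contained in the cross. *)
  have row x : (x < s)%N -> connect e (phi a 0%N) (phi a x).
    elim: x => // x IH xs; have xs' := ltnW xs.
    apply: connect_trans (IH xs') _.
    apply: (wg_ball_connect (C1 (Ordinal xs'))).
    have := ag; rewrite inE => /forallP/(_ (Ordinal xs')).
    by rewrite /hr -ltNge.
  have col x : (x < s)%N -> connect e (phi 0%N b) (phi x b).
    elim: x => // x IH xs; have xs' := ltnW xs.
    apply: connect_trans (IH xs') _.
    apply: (wg_ball_connect (C2 (Ordinal xs'))).
    have := bg; rewrite inE => /forallP/(_ (Ordinal xs')).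
    by rewrite /hc -ltNge.
  apply: (@connected_in_star _ _ _ (phi a b)); first exact: wg_adj_sym.
  move=> v; rewrite inE => /existsP[x /orP[] xv].
    apply: connect_trans (wg_ball_connect (C1 x) xv).
    by apply: connect_trans (row x _) => //; rewrite esym row.
  apply: connect_trans (wg_ball_connect (C2 x) xv).
  by apply: connect_trans (col x _) => //; rewrite esym col.
have CI x y : ~~ [disjoint C x & C y].
  apply/pred0Pn; exists (phi (val x.1) (val y.2)); rewrite /= !inE.
  apply/andP; split; apply/existsP.
    by exists (val y.2); rewrite wg_dist_lt_refl.
  by exists (val x.1); rewrite wg_dist_lt_refl // orbT.
have [B Bk hit] := treewidth_bramble tw Cc CI.
have [a ag anot] : exists2 a, a \in good hr & forall v, v \in B -> a \notin touch phi v.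
  apply: freeP => //.
    by move=> a b a' b' c /dom[].
  apply: leq_ltn_trans few; apply: leq_sum => a _; apply: leq_sum => b _.
  exact: leq_addr.
have [b bg bnot] : exists2 b, b \in good hc & forall v, v \in B -> b \notin touch phi' v.
  apply: freeP => //.
    by move=> a' b a'' b' c /dom[].
  apply: leq_ltn_trans few; rewrite exchange_big.
  apply: leq_sum => a' _; apply: leq_sum => b _; exact: leq_addl.
(* The cross of the untouched row and column must still meet B, which is absurd. *)
have /pred0Pn[v /= /andP[vB]] := hit (exist _ a ag, exist _ b bg).
rewrite inE => /existsP[x /= /orP[] xv].
  by have := anot v vB; rewrite inE => /negP[]; apply/existsP; exists x.
by have := bnot v vB; rewrite inE => /negP[]; apply/existsP; exists x.
Qed.

(** * Summing over boxes and over dyadic scales *)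

(** The square of side N contains m * m disjoint boxes of side s, with corners at the multiples of
    s. *)
Lemma sum_boxes (F : nat -> nat -> nat) (N m s X : nat) : (m * s <= N)%N ->
  (forall p q, (p < m)%N -> (q < m)%N ->
     (X <= \sum_(a < s) \sum_(b < s) F (p * s + a) (q * s + b))%N) ->
  (m * (m * X) <= \sum_(i < N) \sum_(j < N) F i j)%N.
Proof.
have split1 (f : nat -> nat) : (\sum_(i < m * s) f i =
    \sum_(p < m) \sum_(a < s) f (p * s + a))%N.
  rewrite -(big_mkord xpredT f) big_nat_mul big_mkord; apply: eq_bigr => p _.
  rewrite -{1}[(p * s)%N]add0n big_addn mulSn addnK big_mkord.
  by apply: eq_bigr => a _; rewrite addnC.
have widen1 (f : nat -> nat) : (m * s <= N)%N ->
    (\sum_(i < m * s) f i <= \sum_(i < N) f i)%N.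
  move=> /subnKC <-; rewrite big_split_ord /=; exact: leq_addr.
move=> msN FX; apply: leq_trans (widen1 (fun i => \sum_(j < N) F i j)%N msN).
rewrite (split1 (fun i => \sum_(j < N) F i j)%N).
rewrite -[X in (X * _)%N]card_ord -sum_nat_const; apply: leq_sum => p _.
apply: (@leq_trans (\sum_(a < s) \sum_(q < m) \sum_(b < s) F (p * s + a) (q * s + b))%N).
  rewrite exchange_big -[X in (X * _)%N]card_ord -sum_nat_const.
  by apply: leq_sum => q _; apply: FX.
by apply: leq_sum => a _; rewrite -(split1 (F _)) widen1.
Qed.

(** The boolean selects the direction of the edge leaving the given point. The index N occurs only
    as a far endpoint. *)
Definition edge_dist (R : realType) (G : wgraph R) (N : nat)
    (phi : nat -> nat -> 'I_(wg_size G)) (e : 'I_N * 'I_N * bool) : \bar R :=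
  wg_dist (phi e.1.1 e.1.2)
    (if e.2 then phi e.1.1.+1 e.1.2 else phi e.1.1 e.1.2.+1).

(** With X = (k+1)r and s = 4X, each of the m * m boxes has 2X long edges, and N <= 2ms gives N^2 <=
    64 m^2 X^2 = 32 X (2 m^2 X). *)
Lemma stretched_edges (R : realType) (k : nat) (G : wgraph R) (N : nat)
    (phi : nat -> nat -> 'I_(wg_size G)) (r : nat) :
  treewidth_le (@wg_adj R G) k -> noncontracting N phi ->
  (0 < r)%N -> (4 * (k.+1 * r) <= N)%N ->
  (N * N <= 32 * (k.+1 * r) *
     \sum_(e : 'I_N * 'I_N * bool) (r%:R%:E <= edge_dist phi e)%E)%N.
Proof.
move=> tw dom r0; set X := (k.+1 * r)%N; set s := (4 * X)%N => sN.
have s0 : (0 < s)%N by rewrite !muln_gt0.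
pose m := (N %/ s)%N.
have m0 : (0 < m)%N by rewrite divn_gt0.
have msN : (m * s <= N)%N by rewrite leq_trunc_div.
have Nms : (N <= 2 * (m * s))%N.
  have := ltn_ceil N s0; rewrite -/m mulSn => /ltnW /leq_trans; apply.
  by rewrite mul2n -addnn leq_add2r leq_pmull.
apply: leq_trans (leq_mul Nms Nms) _.
have -> : (2 * (m * s) * (2 * (m * s)) = 32 * X * (m * (m * (2 * X))))%N.
  by rewrite /s; lia.
rewrite leq_mul2l; apply/orP; right.
pose F i j := ((r%:R%:E <= wg_dist (phi i j) (phi i j.+1))%E +
      (r%:R%:E <= wg_dist (phi i j) (phi i.+1 j))%E)%N.
have -> : (\sum_(e : 'I_N * 'I_N * bool) (r%:R%:E <= edge_dist phi e)%E =
    \sum_(i < N) \sum_(j < N) F i j)%N.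
  rewrite (pair_bigA _ (fun i j : 'I_N => F i j)) /=.
  rewrite -(pair_bigA _ (fun (p : 'I_N * 'I_N) (b : bool) =>
    (r%:R%:E <= edge_dist phi (p, b))%E : nat)) /=.
  by apply: eq_bigr => -[i j] _; rewrite big_bool /= addnC.
apply: (sum_boxes msN) => p q pm qm.
have in_N p' a : (p' < m)%N -> (a < s)%N -> (p' * s + a < N)%N.
  move=> pm' las; apply: leq_trans msN; apply: (@leq_trans (p'.+1 * s)%N).
    by rewrite mulSn addnC ltn_add2r.
  by rewrite leq_mul2r pm' orbT.
pose psi a b := phi (p * s + a)%N (q * s + b)%N.
have := @box_stretched_edges R k G psi r s tw r0 (leqnn _).
rewrite /F /psi.
under eq_bigr do under eq_bigr do rewrite !addnS.
apply=> a b a' b' c as_ bs as' bs' /dom[]; rewrite ?in_N //.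
by rewrite !natrD -!addrA !ltrD2l.
Qed.

(** The powers of two not exceeding t sum to at most twice the largest of them, hence to at most
    2t. *)
Lemma dyadic_sum_le (R : realType) (L : nat) (t : \bar R) : (0 <= t)%E ->
  (((\sum_(l < L) 2 ^ l * ((2 ^ l)%:R%:E <= t)%E)%N%:R / 2)%:E <= t)%E.
Proof.
case: t => [t| |] // t0; last by rewrite leey.
rewrite lee_fin ler_pdivrMr //; rewrite lee_fin in t0.
elim: L => [|L IH]; first by rewrite big_ord0 mulr_ge0.
rewrite big_ord_recr /= lee_fin.
case: (leP (2 ^ L)%:R t) => Lt; last by rewrite muln0 addn0.
rewrite muln1 natrD mulr_natr mulr2n lerD //.
apply: le_trans Lt; rewrite ler_nat; elim: (L) => [|l IHl].
  by rewrite big_ord0.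
rewrite big_ord_recr expnS mul2n -addnn leq_add //=.
by rewrite -[leqRHS]muln1 leq_mul // leq_b1.
Qed.

(** At scale 2^l the long edges, weighted by 2^l, contribute at least N^2 / (32(k+1)) whatever l is;
    the dyadic sum loses a factor 2. *)
Lemma sum_edge_dist_ge (R : realType) (k : nat) (G : wgraph R) (N L : nat)
    (phi : nat -> nat -> 'I_(wg_size G)) :
  treewidth_le (@wg_adj R G) k -> noncontracting N phi ->
  (forall l, (l < L)%N -> (4 * (k.+1 * 2 ^ l) <= N)%N) ->
  (((L * (N * N))%:R / (64 * k.+1)%:R)%:E
     <= \sum_(e : 'I_N * 'I_N * bool) edge_dist phi e)%E.
Proof.
move=> tw dom LN.
pose y (e : 'I_N * 'I_N * bool) := 
  (\sum_(l < L) 2 ^ l * ((2 ^ l)%:R%:E <= edge_dist phi e)%E)%N.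
apply: (@le_trans _ _ (\sum_e ((y e)%:R / 2)%:E)%E); last first.
  by apply: lee_sum => e _; apply: dyadic_sum_le; apply: wg_dist_ge0.
rewrite sumEFin lee_fin -mulr_suml -natr_sum.
rewrite ler_pdivrMr ?ltr0n // mulrAC ler_pdivlMr // -!natrM ler_nat.
rewrite /y exchange_big /=.
have -> : (64 * k.+1 = 32 * k.+1 * 2)%N by lia.
rewrite [X in (_ <= X)%N]mulnA leq_mul2r /= big_distrl /=.
rewrite -[X in (X * _)%N]card_ord -sum_nat_const.
apply: leq_sum => l _.
apply: leq_trans (stretched_edges tw dom _ (LN _ (ltn_ord l))) _.
  by rewrite expn_gt0.
by rewrite -big_distrr /=; lia.
Qed.

(** * Expected total length and the grid metric *)

Lemma average_ge (R : realType) (d : measure_display) (Omega : measurableType d)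
    (P : probability Omega R) (I : finType) (f : I -> Omega -> \bar R) (c alpha : R) :
  (forall i, measurable_fun setT (f i)) -> (forall i w, (0 <= f i w)%E) ->
  (forall i, (\int[P]_w f i w <= alpha%:E)%E) ->
  (forall w, (c%:E <= \sum_i f i w)%E) -> 0 <= c -> c <= #|I|%:R * alpha.
Proof.
move=> mf f0 fa cf c0; rewrite -lee_fin.
have -> : c%:E = (\int[P]_w (cst c%:E w))%E.
  by rewrite integral_cst //= probability_setT mule1.
apply: (@le_trans _ _ (\int[P]_w (\sum_i f i w))%E).
  by apply: ge0_le_integral => //; apply: emeasurable_sum.
rewrite ge0_integral_sum //.
apply: le_trans (lee_sum _ (fun i _ => fa i)) _.
by rewrite sumEFin sumr_const mulr_natl.
Qed.

(** One step of a walk changes each coordinate by at most one. *)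
Lemma grid_walk_coord (n : nat) (x : 'I_n * 'I_n) (s : seq ('I_n * 'I_n)) :
  path (grid_adj (n:=n)) x s ->
  (x.1 <= (last x s).1 + size s)%N /\ (x.2 <= (last x s).2 + size s)%N.
Proof.
elim: s x => [|y s IH] x /=; first by rewrite !addn0.
case/andP=> xy /IH[]; move: xy; rewrite /grid_adj -!val_eqE /=; lia.
Qed.

Lemma walk_cost1 (R : realType) (T : Type) (x : T) (s : seq T) :
  walk_cost (fun _ _ => 1 : R) x s = (size s)%:R.
Proof. by elim: s x => //= y s IH x; rewrite IH -natr1 addrC. Qed.

Lemma grid_dist_coord (R : realType) (n : nat) (x y : 'I_n * 'I_n) (c : R) :
  (grid_dist R x y < c%:E)%E ->
  (x.1%:R : R) < y.1%:R + c /\ (x.2%:R : R) < y.2%:R + c.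
Proof.
case/ereal_inf_lt => _ [s [/grid_walk_coord[x1 x2] <-] <-].
rewrite lte_fin walk_cost1 => sc.
split.
  by apply: (@le_lt_trans _ _ ((last x s).1%:R + (size s)%:R));
    rewrite ?ltrD2l // -natrD ler_nat.
by apply: (@le_lt_trans _ _ ((last x s).2%:R + (size s)%:R));
    rewrite ?ltrD2l // -natrD ler_nat.
Qed.

Lemma grid_dist_adj (R : realType) (n : nat) (x y : 'I_n * 'I_n) :
  grid_adj x y -> x != y -> grid_dist R x y = 1%:E.
Proof.
move=> xy xny; apply/eqP; rewrite eq_le; apply/andP; split.
  apply: ereal_inf_lbound; exists [:: y]; first by rewrite /= xy.
  by rewrite walk_cost1.
apply: le_ereal_inf_tmp => _ [s [_ xs] <-]; rewrite lee_fin walk_cost1 ler1n.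
by case: s xs => //= xs; rewrite xs eqxx in xny.
Qed.

(** Each of the 2N^2 edges has expected length at most alpha, so 2N^2 alpha >= L N^2 / (64(k+1)).
    Side N+1 keeps all far endpoints inside the grid. *)
Lemma tw_approx_ge (R : realType) (k N L : nat)
    (d : measure_display) (Omega : measurableType d) (P : probability Omega R)
    (H : Omega -> wgraph R) (Phi : forall w, 'I_N.+1 * 'I_N.+1 -> 'I_(wg_size (H w)))
    (alpha : R) :
  tw_approx k P Phi alpha -> (0 < N)%N ->
  (forall l, (l < L)%N -> (4 * (k.+1 * 2 ^ l) <= N)%N) ->
  L%:R <= (128 * k.+1)%:R * alpha.
Proof.
case=> tw mPhi dom avg N0 LN.
pose pt i j : 'I_N.+1 * 'I_N.+1 := (inord i, inord j).
pose phi w i j := Phi w (pt i j).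
pose tgt (e : 'I_N * 'I_N * bool) :=
  if e.2 then pt e.1.1.+1 e.1.2 else pt e.1.1 e.1.2.+1.
have phiE w (e : 'I_N * 'I_N * bool) :
    edge_dist (phi w) e = wg_dist (Phi w (pt e.1.1 e.1.2)) (Phi w (tgt e)).
  by rewrite /edge_dist /phi /tgt; case: e.2.
have tgt1 (e : 'I_N * 'I_N * bool) : grid_dist R (pt e.1.1 e.1.2) (tgt e) = 1%:E.
  case: e => -[i j] b; have iN := ltn_ord i; have jN := ltn_ord j.
  apply: grid_dist_adj; rewrite /tgt /=; case: b;
    rewrite /grid_adj ?xpair_eqE -!val_eqE /= !inordK //; lia.
have : (L * (N * N))%:R / (64 * k.+1)%:R <= #|{: 'I_N * 'I_N * bool}|%:R * alpha.
  apply: (@average_ge R d Omega P _ (fun e w => edge_dist (phi w) e)).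
  - move=> e; rewrite (_ : (fun _ => _) =
      fun w => wg_dist (Phi w (pt e.1.1 e.1.2)) (Phi w (tgt e))) //.
    by apply/funext => w; rewrite phiE.
  - by move=> e w; apply: wg_dist_ge0.
  - move=> e; under eq_integral do rewrite phiE.
    by apply: le_trans (avg _ _) _; rewrite tgt1 mule1.
  - move=> w; apply: sum_edge_dist_ge => // a b a' b' c aN bN aN' bN' abc.
    have := grid_dist_coord (le_lt_trans (dom w _ _) abc).
    by rewrite /= !inordK // ltnW.
  - by rewrite divr_ge0.
rewrite !card_prod !card_ord card_bool ler_pdivrMr ?ltr0n //.
have NN : 0 < (N * N)%:R :> R by rewrite ltr0n muln_gt0 N0.
move=> le_alpha; rewrite -(ler_pM2r NN) -natrM; apply: le_trans le_alpha _.
by rewrite !natrM; lra.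
Qed.

(** * The logarithmic lower bound *)

Theorem theorem2 (R : realType) (k : nat) :
  exists c : R, 0 < c /\
  exists N : nat, forall n : nat, (N <= n)%N ->
  forall (d : measure_display) (Omega : measurableType d)
         (P : probability Omega R) (H : Omega -> wgraph R)
         (Phi : forall w, 'I_n * 'I_n -> 'I_(wg_size (H w))) (alpha : R),
    tw_approx k P Phi alpha -> c * ln (n%:R) <= alpha.
Proof.
have K0 : 0 < (256 * k.+1)%:R :> R by rewrite ltr0n.
exists (256 * k.+1)%:R^-1; split; first by rewrite invr_gt0.
(* This threshold forces t >= 2k+8, where t is the integer part of log2 n, so that t+1 <= 2(t-k-3)
   below. *)
exists (2 ^ (2 * k.+4))%N => -[|N] nN d Omega P H Phi alpha app.
  by move: nN; rewrite leqn0 expn_eq0.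
have n_lt := trunc_log_ltn N.+1 (isT : (1 < 2)%N).
have n_ge := trunc_logP (isT : (1 < 2)%N) (isT : (0 < N.+1)%N).
have t_ge := trunc_log_max (isT : (1 < 2)%N) nN.
set t := trunc_log 2 N.+1 in n_lt n_ge t_ge.
(* For l < t-k-3, the bound k+1 <= 2^(k+1) gives 4(k+1)2^l <= 2^(t-1), which is at most n-1. *)
have L_le : (t - k.+3)%:R <= (128 * k.+1)%:R * alpha.
  apply: tw_approx_ge app _ _.
    by rewrite -ltnS; apply: leq_trans nN; rewrite -[2%N]/(2 ^ 1)%N leq_exp2l.
  move=> l lt_l; apply: (@leq_trans (2 ^ t.-1)%N).
    apply: (@leq_trans (2 ^ (2 + (k.+1 + l)))%N); last by rewrite leq_exp2l //; lia.
    by rewrite !expnD leq_mul // leq_mul // ltnW // ltn_expl.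
  rewrite -ltnS; apply: leq_trans n_ge.
  have -> : t = t.-1.+1 by lia.
  by rewrite expnS mul2n -addnn /= -[X in (X < _)%N]addn0 ltn_add2l expn_gt0.
rewrite mulrC ler_pdivrMr //.
(* Here n < 2^(t+1), and ln 2 <= 1 follows from ln(1+x) <= x at x = 1. *)
have ln_le : ln N.+1%:R <= t.+1%:R :> R.
  apply: (@le_trans _ _ (ln (2 ^+ t.+1))).
    by rewrite ler_ln ?posrE ?exprn_gt0 ?ltr0n // -natrX ler_nat ltnW.
  rewrite lnXn // -[leLHS]mulr_natl -[leRHS]mulr1 ler_wpM2l //.
  by have := @le_ln1Dx R 1; rewrite -natr1; apply; lra.
apply: le_trans ln_le _.
have t2L : t.+1%:R <= 2 * (t - k.+3)%:R :> R.
  by rewrite -natrM ler_nat; lia.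
apply: le_trans t2L _.
have -> : (256 * k.+1)%:R = 2 * (128 * k.+1)%:R :> R.
  by rewrite -natrM; congr (_%:R); lia.
by rewrite mulrC mulrA [alpha * _]mulrC -mulrA; lra.
Qed.
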